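(* Let $q$ be a positive real algebraic number. The weight $w_q$ is unique in each of the following two cases: (i) for some $\sigma\in\mathrm{Gal}(\overline{\mathbb Q}/\mathbb Q)$ the conjugate $q^\sigma$ is real and satisfies $q^\sigma\ge4$; (ii) $q$ is a totally positive algebraic integer.
   Context: Let $q>0$. For an integer $k\ge0$ and $\mathbf m=(m_0,\dots,m_k)\in\mathbb Z^{k+1}$ put $\mathbf m_j=(m_0,\dots,m_j)$. Define $c(q,\mathbf m_0)=m_0$ and recursively $c(q,\mathbf m_j)=m_j+\frac{1}{q\,c(q,\mathbf m_{j-1})}$ for $1\le j\le k$. The vector $\mathbf m$ is a path for $q$ (of length $k$) if $c(q,\mathbf m_j)\ne0$ for $0\le j\le k-1$. The weight of a path is $w_q(\mathbf m)=q^{k/2}\prod_{j=0}^{k-1}|c(q,\mathbf m_j)|$ (and $w_q(\mathbf m)=1$ if $k=0$). The weight $w_q$ is called unique if $w_q(\mathbf m)=w_q(\mathbf n)$ for all paths $\mathbf m,\mathbf n$ for $q$ with $c(q,\mathbf m)=c(q,\mathbf n)$. *)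

(* Defs.v *)
From HB Require Import structures.
From mathcomp Require Import all_boot all_order all_algebra all_field.
Set Implicit Arguments. Unset Strict Implicit. Unset Printing Implicit Defensive.
Import Order.TTheory GRing.Theory Num.Theory.
Local Open Scope ring_scope.

Definition cq (q : algC) (m : seq int) : algC :=
  foldl (fun c a => a%:~R + (q * c)^-1) ((head 0 m)%:~R) (behead m).

(* length k of m = (m_0,...,m_k) *)
Definition plen (m : seq int) : nat := (size m).-1.

Definition is_path (q : algC) (m : seq int) : Prop :=
  (0 < size m)%N /\ forall j : nat, (j < plen m)%N -> cq q (take j.+1 m) != 0.

Definition weight (q : algC) (m : seq int) : algC :=
  sqrtC q ^+ plen m * \prod_(j < plen m) `|cq q (take j.+1 m)|.

Definition weight_unique (q : algC) : Prop :=
  forall m n : seq int, is_path q m -> is_path q n -> cq q m = cq q n ->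
    weight q m = weight q n.

(* Main.v *)
Require Import Defs.
From HB Require Import structures.
From mathcomp Require Import all_boot all_order all_algebra all_field.
From mathcomp Require Import ring zify.
From Stdlib Require Import Classical.
Import Order.TTheory GRing.Theory Num.Theory.
Local Open Scope ring_scope.
Set Implicit Arguments. Unset Strict Implicit. Unset Printing Implicit Defensive.

(** With [q = l^2], a path is a word in the matrices [[l a, 1], [1, 0]], that is, in the
  generators [[1, l], [0, 1]] and [[0, 1], [1, 0]] of an extended Hecke group; its weight is the
  absolute value of the lower entry of the image of [(1, 0)].  Hence [w_q] is unique as soon as
  every group element mapping [(1, 0)] to [(t, 0)] has [t = 1] or [t = -1].  Squares of weights
  are rational functions of [q], so uniqueness can be tested at any positive conjugate of [q].

  If [l >= 2], a reduced word expands, so only trivial words fix infinity.  Otherwise [q] is an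
  algebraic integer all of whose conjugates lie in [(0, 4)], and by Kronecker's theorem it is
  conjugate to [4 cos^2 (pi / n)] for some [n >= 3], for which the group is the extended
  triangle group [(2, n, oo)].  There, up to signs, the orbit of [(1, 0)] is contained in a set of
  vectors generated by nonnegative matrices, in which [(1, 0)] is the only multiple of itself. *)

(** * Paths as words in the extended Hecke group *)

Definition hecke_step (l : algC) (a : int) (v : algC * algC) : algC * algC :=
  (l * a%:~R * v.1 + v.2, v.1).

Definition hecke (l : algC) (s : seq int) (v : algC * algC) := foldr (hecke_step l) v s.

Definition unit_cusp (l : algC) :=
  forall (s : seq int) (t : algC), hecke l s (1, 0) = (t, 0) -> t ^+ 2 = 1.

Lemma hecke_cat l s t v : hecke l (s ++ t) v = hecke l s (hecke l t v).
Proof. exact: foldr_cat. Qed.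

Lemma heckeZ l s t x y :
  hecke l s (t * x, t * y) = (t * (hecke l s (x, y)).1, t * (hecke l s (x, y)).2).
Proof.
elim: s => //= a s ->; rewrite /hecke_step /=; congr pair; ring.
Qed.

(** The matrix of the letter [a] has inverse [[[0, 1], [1, - l a]]], the product of the matrices of
    [0], [- a], [0]. *)
Lemma hecke_inv l s : exists s', cancel (hecke l s) (hecke l s').
Proof.
elim: s => [|a s [s' s'K]]; first by exists [::].
exists (s' ++ [:: 0; - a; 0]) => v; rewrite hecke_cat /= -[RHS]s'K; congr hecke.
case: (hecke l s v) => x y; rewrite /hecke_step /=; congr pair; rewrite !mulrNz; ring.
Qed.

Lemma cq_rcons q m a : (0 < size m)%N -> cq q (rcons m a) = a%:~R + (q * cq q m)^-1.
Proof. by case: m => // b m _; rewrite /cq /= -cats1 foldl_cat. Qed.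

Lemma path_rcons q m a :
  (0 < size m)%N -> is_path q (rcons m a) -> is_path q m /\ cq q m != 0.
Proof.
move=> m0 [_ Pm]; rewrite /plen size_rcons /= in Pm.
have tk j : (j < size m)%N -> take j.+1 (rcons m a) = take j.+1 m.
  by move=> jm; rewrite -cats1 takel_cat.
split.
  split=> // j; rewrite /plen => jm; have jm' : (j < size m)%N by lia.
  by rewrite -tk //; apply: Pm.
have lt : ((size m).-1 < size m)%N by rewrite prednK.
by have := Pm _ lt; rewrite tk // prednK // take_size.
Qed.

Lemma weight_rcons q m a : (0 < size m)%N ->
  weight q (rcons m a) = weight q m * (sqrtC q * `|cq q m|).
Proof.
move=> m0; rewrite /weight /plen size_rcons /= -[in LHS](prednK m0) big_ord_recr /=.
have -> : take (size m).-1.+1 (rcons m a) = m by rewrite prednK // -cats1 takel_cat // take_size.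
rewrite exprSr mulrACA; congr (_ * _ * _).
by apply: eq_bigr => j _; rewrite -cats1 takel_cat // (leq_trans (ltn_ord j)) ?leq_pred.
Qed.

(** If [c = x / (l y)], a new entry [a] leads to [(l a x + y) / (l x)] and multiplies the weight by
    [l |c| = |x / y|]. The word is reversed because [hecke] applies its last letter first. *)
Lemma path_hecke l m : 0 < l -> is_path (l ^+ 2) m ->
  let v := hecke l (rev m) (1, 0) in
  [/\ v.2 != 0, cq (l ^+ 2) m = v.1 / (l * v.2) & weight (l ^+ 2) m = `|v.2|].
Proof.
move=> l0; have ln0 : l != 0 by rewrite gt_eqF.
elim/last_ind: m => [[]//|m a IH] Pm.
have [/eqP|m0] := posnP (size m).
  move/nilP => ->; rewrite /= /hecke_step /= oner_neq0 /cq /weight /= /plen /= big_ord0.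
  split=> //; last by rewrite expr0 normr1 mulr1.
  by rewrite addr0 !mulr1 mulrC mulKf.
have [/IH [v2 Ec Ew] c0] := path_rcons m0 Pm.
rewrite rev_rcons /= /hecke_step /=; move: (hecke _ _ _) v2 Ec Ew => [x y] /= y0 Ec Ew.
have x0 : x != 0 by apply: contraNneq c0; rewrite Ec => ->; rewrite mul0r.
split=> //; first by rewrite cq_rcons // Ec; field; rewrite x0 y0 ln0.
rewrite weight_rcons // Ew Ec rootCX ?ltW // sqrtCK.
by rewrite -{1}(gtr0_norm l0) -!normrM; congr `|_|; field; rewrite y0.
Qed.

(* If two paths end at the same value, the quotient of their matrices fixes infinity and scales
  [(1, 0)] by the quotient of the weights, up to sign. *)
Lemma unit_cusp_weight_unique l : 0 < l -> unit_cusp l -> weight_unique (l ^+ 2).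
Proof.
move=> l0 Kl m n /(path_hecke l0) [m2 cm wm] /(path_hecke l0) [n2 cn wn] cmn.
have ln0 : l != 0 by rewrite gt_eqF.
have [s' s'K] := hecke_inv l (rev n).
case Em: (hecke l (rev m) (1, 0)) m2 cm wm => [x y] /= y0 cm wm.
case En: (hecke l (rev n) (1, 0)) n2 cn wn => [z w] /= w0 cn wn.
have Et : (x, y) = (y / w * z, y / w * w).
  congr pair; last by rewrite divfK.
  have -> : x = cq (l ^+ 2) m * (l * y) by rewrite cm; field; rewrite y0 ln0.
  by rewrite cmn cn; field; rewrite w0 ln0.
have /Kl : hecke l (s' ++ rev m) (1, 0) = (y / w, 0).
  by rewrite hecke_cat Em Et heckeZ -En s'K /= mulr1 mulr0.
move/eqP; rewrite wm wn sqrf_eq1 => /orP[] /eqP yw.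
  by rewrite -[y](divfK w0) yw mul1r.
by rewrite -[y](divfK w0) yw mulN1r normrN.
Qed.

(** * Transport along automorphisms of the algebraic numbers *)

Lemma cq_aut (nu : {rmorphism algC -> algC}) q m : cq (nu q) m = nu (cq q m).
Proof.
elim/last_ind: m => [|m a IH]; first by rewrite /cq /= rmorph_int.
have [/eqP|m0] := posnP (size m); first by move/nilP => ->; rewrite /cq /= rmorph_int.
by rewrite !cq_rcons // IH rmorphD rmorph_int fmorphV rmorphM.
Qed.

Lemma cq_real q m : q \is Num.real -> cq q m \is Num.real.
Proof.
move=> qR; elim/last_ind: m => [|m a IH]; first by rewrite /cq /= realz.
have [/eqP|m0] := posnP (size m); first by move/nilP => ->; rewrite /cq /= realz.
by rewrite cq_rcons // rpredD ?realz // rpredV rpredM.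
Qed.

(** Squaring removes the square root and the absolute values; what is left commutes with
    automorphisms. *)
Lemma weight_sqr q m : q \is Num.real ->
  weight q m ^+ 2 = q ^+ plen m * \prod_(j < plen m) cq q (take j.+1 m) ^+ 2.
Proof.
move=> qR; rewrite /weight exprMn exprAC sqrtCK -prodrXl; congr (_ * _).
by apply: eq_bigr => j _; rewrite real_normK // cq_real.
Qed.

Lemma weight_ge0 q m : 0 <= q -> 0 <= weight q m.
Proof. by move=> q0; rewrite mulr_ge0 ?exprn_ge0 ?sqrtC_ge0 ?prodr_ge0. Qed.

Lemma weight_unique_aut (nu : {rmorphism algC -> algC}) q :
  0 < q -> 0 < nu q -> weight_unique (nu q) -> weight_unique q.
Proof.
move=> q0 nq0 U m n Pm Pn E.
have Pnu p : is_path q p -> is_path (nu q) p.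
  by move=> [p0 Pp]; split=> // j /Pp; rewrite cq_aut fmorph_eq0.
have nw p : nu (weight q p ^+ 2) = weight (nu q) p ^+ 2.
  rewrite !weight_sqr ?gtr0_real // rmorphM rmorphXn rmorph_prod; congr (_ * _).
  by apply: eq_bigr => j _; rewrite cq_aut rmorphXn.
have w2 : weight q m ^+ 2 = weight q n ^+ 2.
  apply: (fmorph_inj nu); rewrite !nw; congr (_ ^+ 2); apply: U; try exact: Pnu.
  by rewrite !cq_aut E.
by apply/eqP; rewrite -(eqrXn2 (n := 2)) ?weight_ge0 ?ltW // w2.
Qed.

(** * Expansion for [l >= 2] *)

Fixpoint hecke_reduced (s : seq int) : bool := if s is _ :: s' then 0 \notin s' else true.

(** The letters [a], [0], [c] act together as [a + c], and [a], [0] together fix [(1, 0)]. The head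
    is exempt from being nonzero because [a + c] may vanish. *)
Lemma hecke_reduce l s :
  exists2 r, hecke_reduced r & hecke l r (1, 0) = hecke l s (1, 0).
Proof.
elim: s => [|a s [r rr Er]]; first by exists [::].
rewrite /= -Er; case: r rr {Er} => [|b r] /= rr; first by exists [:: a].
have [-> {b}|b0] := eqVneq b 0; last first.
  by exists (a :: b :: r); rewrite //= inE negb_or eq_sym b0.
case: r rr => [|c r] /= rr.
  exists [::] => //; rewrite /= /hecke_step /= mulr0z; congr pair; ring.
exists (a + c :: r); first by move: rr; rewrite inE negb_or => /andP[].
rewrite /=; case: (hecke _ _ _) => x y; rewrite /hecke_step /= intrD mulr0z; congr pair; ring.
Qed.

(** As [|l a| >= 2], one has [|l a x + y| >= 2 |x| - |y| >= |x|]. *)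
Lemma hecke_expand l s : 2 <= l -> 0 \notin s ->
  let v := hecke l s (1, 0) in 0 < `|v.1| /\ `|v.2| <= `|v.1|.
Proof.
move=> l2; elim: s => [|a s IH] /=; first by rewrite normr0 normr1 ltr01 ler01.
rewrite inE negb_or eq_sym => /andP[a0 /IH]; rewrite /hecke_step /=.
case: (hecke _ _ _) => x y /= [x0 yx].
suff le : `|x| <= `|l * a%:~R * x + y| by split=> //; apply: lt_le_trans le.
have la : 2 <= `|l * a%:~R|.
  rewrite normrM ger0_norm ?(le_trans _ l2) // -[2]mulr1 ler_pM //.
  by rewrite -intr_norm ler1z; lia.
apply: le_trans (lerB_normD _ _); rewrite normrM lerBrDr (le_trans (lerD (lexx _) yx)) //.
by rewrite -mulr2n -mulr_natl ler_wpM2r.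
Qed.

Lemma unit_cusp_ge2 l : 2 <= l -> unit_cusp l.
Proof.
move=> l2 s t; have [r rr <-] := hecke_reduce l s.
case: r rr => [_ [<-]|a r /= rr]; first by rewrite expr1n.
rewrite /hecke_step; case: (hecke_expand l2 rr) => x0 _ [_ x_eq].
by rewrite x_eq normr0 ltxx in x0.
Qed.

(* For [s k = sin (k pi / n) / sin (pi / n)], the step matrices [[s k, s (k-1)], [s (k+1), s k]] are,
  up to involutions on both sides, the nontrivial powers of the rotation of order [n]. *)
Inductive hecke_cone (n : nat) (s : nat -> algC) : algC -> algC -> Prop :=
| HeckeCone10 : hecke_cone n s 1 0
| HeckeCone01 : hecke_cone n s 0 1
| HeckeConeStep k x y : (0 < k < n)%N -> hecke_cone n s x y ->
    hecke_cone n s (s k * x + s k.-1 * y) (s k.+1 * x + s k * y).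

(** The signs are independent, so that the set is stable under negating one coordinate; this
    exchanges the translations by [l] and [- l]. *)
Definition hecke_orbit n s (v : algC * algC) :=
  exists x y (b c : bool), hecke_cone n s x y /\ v = ((-1) ^+ b * x, (-1) ^+ c * y).

(** * The triangle group *)

Section TriangleGroup.
Variables (n : nat) (s : nat -> algC) (l : algC).
Hypothesis n_gt1 : (1 < n)%N.
Hypotheses (s0 : s 0 = 0) (s1 : s 1 = 1) (srec : forall k, s k.+2 = l * s k.+1 - s k).
Hypotheses (sn : s n = 0) (s_gt0 : forall k, (0 < k < n)%N -> 0 < s k).
Hypothesis s_sym : forall k, (k <= n)%N -> s (n - k) = s k.

Let s2 : s 2 = l. Proof. by rewrite srec s0 s1 mulr1 subr0. Qed.

Let sn1 : s n.-1 = 1. Proof. by rewrite -subn1 s_sym // ltnW. Qed.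

Let sn2 : s n.-2 = l. Proof. by rewrite -subn2 s_sym. Qed.

Let s_ge0 k : (k <= n)%N -> 0 <= s k.
Proof.
case: k => [|k]; first by rewrite s0.
rewrite leq_eqVlt => /orP[/eqP->|kn]; first by rewrite sn.
by rewrite ltW // s_gt0.
Qed.

(** Conjugation by the swap turns step [k] into step [n - k], by the symmetry of [s]. *)
Lemma hecke_cone_swap x y : hecke_cone n s x y -> hecke_cone n s y x.
Proof.
elim=> [||k {}x {}y /andP[k0 kn] _ IH]; [exact: HeckeCone01|exact: HeckeCone10|].
have nk : (0 < n - k < n)%N by lia.
have := HeckeConeStep nk IH; rewrite -subnS -subSn 1?ltnW // -(prednK k0) subSS prednK //.
rewrite !s_sym //; try lia.
by rewrite [_ * y + _]addrC [_ * y + s k * x]addrC.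
Qed.

Lemma hecke_cone_ge0 x y : hecke_cone n s x y -> [/\ 0 <= x, 0 <= y & x + y != 0].
Proof.
elim=> [||k {}x {}y kn _ [x0 y0 xy0]]; try by split; rewrite ?addr0 ?add0r ?oner_neq0.
have [k0 kn'] := andP kn.
have k1 : (k.-1 <= n)%N by lia.
have := s_gt0 kn; have := s_ge0 k1; have := s_ge0 kn' => sk1 sk sk0.
split; try by rewrite addr_ge0 // mulr_ge0 // ltW.
rewrite addrACA -!mulrDl gt_eqF //.
have a0 : 0 < s k + s k.+1 by rewrite ltr_wpDr.
have b0 : 0 < s k.-1 + s k by rewrite ltr_wpDl.
move: xy0; rewrite paddr_eq0 // negb_and => /orP[] z0.
  have xp : 0 < x by rewrite lt0r z0.
  by rewrite ltr_wpDr ?mulr_gt0 // mulr_ge0 // ltW.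
have yp : 0 < y by rewrite lt0r z0.
by rewrite ltr_wpDl ?mulr_gt0 // mulr_ge0 // ltW.
Qed.

(** The lower entry is a sum of nonnegative terms. It vanishes only for [y = 0] and [k = n - 1], and
    that step fixes [(x, 0)]. *)
Lemma hecke_cone_cusp x y : hecke_cone n s x y -> y = 0 -> x = 1.
Proof.
elim=> [||k {}x {}y kn C IH]; [by []|by move/eqP; rewrite oner_eq0|].
have [x0 y0 xy0] := hecke_cone_ge0 C; have sk := s_gt0 kn; have [k0 kn'] := andP kn.
move/eqP; rewrite paddr_eq0 ?mulr_ge0 ?(ltW sk) ?s_ge0 // !mulf_eq0 (gt_eqF sk) /=.
case/andP=> /orP[] /eqP E /eqP Ey; last by rewrite E Ey addr0 eqxx in xy0.
have -> : k = n.-1.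
  suff : ~~ (k.+1 < n)%N by lia.
  by apply/negP => kn1; move: (@s_gt0 k.+1 kn1); rewrite E ltxx.
by rewrite sn1 Ey (IH Ey) mulr0 mul1r addr0.
Qed.

(** Step [n - 1] is the translation [[[1, l], [0, 1]]]. *)
Lemma hecke_cone_translate x y : hecke_cone n s x y -> hecke_cone n s (x + l * y) y.
Proof.
have nn : (0 < n.-1 < n)%N by lia.
move/(HeckeConeStep nn); rewrite prednK 1?ltnW // sn sn1 sn2.
by rewrite !mul1r mul0r add0r.
Qed.

Lemma hecke_orbitN v : hecke_orbit n s v -> hecke_orbit n s (- v.1, - v.2).
Proof.
case=> x [y [b [c [C ->]]]]; exists x, y, (~~ b), (~~ c); split=> //.
by rewrite !signrN !mulNr.
Qed.

Lemma hecke_orbit_swap v : hecke_orbit n s v -> hecke_orbit n s (v.2, v.1).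
Proof.
by case=> x [y [b [c [/hecke_cone_swap C ->]]]]; exists y, x, c, b.
Qed.

Lemma hecke_orbit_flip v : hecke_orbit n s v -> hecke_orbit n s (v.1, - v.2).
Proof.
case=> x [y [b [c [C ->]]]]; exists x, y, b, (~~ c); split=> //.
by rewrite !signrN !mulNr.
Qed.

Lemma hecke_cone_orbit x y : hecke_cone n s x y -> hecke_orbit n s (x, y).
Proof. by move=> C; exists x, y, false, false; rewrite !mul1r. Qed.

(** By the recurrence, undoing the translation after step [k] gives step [k + 1] up to sign and
    swap. Step [n - 1] is itself the translation, so there the previous vector comes back. *)
Lemma hecke_cone_reflect x y :
  hecke_cone n s x y -> hecke_orbit n s (x - l * y, - y).
Proof.
case=> [||k {}x {}y kn C].
- by rewrite mulr0 subr0; exact: (hecke_orbit_flip (hecke_cone_orbit (HeckeCone10 n s))).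
- have := hecke_cone_translate (HeckeCone01 n s).
  by move/hecke_cone_orbit/hecke_orbitN; rewrite /= add0r mulr1 sub0r.
have [k0 kn1] := andP kn; have := srec k.-1; rewrite prednK // => E1.
have -> : s k * x + s k.-1 * y - l * (s k.+1 * x + s k * y) =
    - (s k.+2 * x + s k.+1 * y) by rewrite srec E1; ring.
have := kn1; rewrite leq_eqVlt => /orP[/eqP Ek|kn2].
  have Ek' : k = n.-1 by lia.
  rewrite srec Ek sn Ek' sn1 !mul0r mul1r mulr0 sub0r addr0 mulN1r opprK add0r.
  exact: (hecke_orbit_flip (hecke_cone_orbit C)).
have kn3 : (0 < k.+1 < n)%N by [].
exact: (hecke_orbitN (hecke_orbit_swap (hecke_cone_orbit (HeckeConeStep kn3 C)))).
Qed.

(** Equal signs lead to a translation inside the cone, opposite signs to the reflected case. *)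
Lemma hecke_orbit_translate v : hecke_orbit n s v -> hecke_orbit n s (v.1 + l * v.2, v.2).
Proof.
case=> x [y [b [c [C ->]]]] /=.
have [Eb|Eb] := eqVneq c b; rewrite ?Eb.
  rewrite mulrCA -mulrDr; have := hecke_cone_orbit (hecke_cone_translate C).
  by case: b Eb => _; rewrite ?mul1r // !mulN1r; apply: hecke_orbitN.
have -> : c = ~~ b by case: b c Eb => [] [].
rewrite signrN !mulNr mulrN mulrCA -mulrBr -mulrN; have := hecke_cone_reflect C.
by case: (b); rewrite ?mul1r // !mulN1r; apply: hecke_orbitN.
Qed.

Lemma hecke_orbit_translateN v : hecke_orbit n s v -> hecke_orbit n s (v.1 - l * v.2, v.2).
Proof.
move/hecke_orbit_flip/hecke_orbit_translate/hecke_orbit_flip.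
by rewrite /= mulrN opprK.
Qed.

Lemma hecke_orbit_translatez (a : int) v :
  hecke_orbit n s v -> hecke_orbit n s (v.1 + l * a%:~R * v.2, v.2).
Proof.
case: v => x y O; elim/int_rec: a => [|a IH|a IH] /=.
- by rewrite mulr0 mul0r addr0.
- have := hecke_orbit_translate IH; rewrite /= -addrA.
  by congr (hecke_orbit n s (_ + _, _)); rewrite intS intrD; ring.
have := hecke_orbit_translateN IH; rewrite /= -addrA.
by congr (hecke_orbit n s (_ + _, _)); rewrite intS opprD intrD; ring.
Qed.

Lemma triangle_unit_cusp : unit_cusp l.
Proof.
move=> w t E; have : hecke_orbit n s (hecke l w (1, 0)).
  elim: (w) => [|a w' IH] /=; first exact/hecke_cone_orbit/HeckeCone10.
  have := hecke_orbit_translatez a (hecke_orbit_swap IH).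
  by rewrite /= addrC.
rewrite E => -[x [y [b [c [C [-> Ey]]]]]].
have y0 : y = 0 by apply/eqP; move/esym/eqP: Ey; rewrite mulf_eq0 signr_eq0.
by rewrite (hecke_cone_cusp C y0) mulr1 sqrr_sign.
Qed.

End TriangleGroup.

(** * Roots of unity *)

(** The cosine decreases on [(0, pi)]; the sign of ['Im (z / w)] compares the two angles. *)
Lemma Re_lt_of_Im_div_lt0 (z w : algC) : `|z| = 1 -> `|w| = 1 ->
  0 < 'Im z -> 0 < 'Im w -> 'Im (z / w) < 0 -> 'Re w < 'Re z.
Proof.
move=> z1 w1; rewrite Im_div w1 expr1n divr1.
have := normC2_Re_Im z; have := normC2_Re_Im w; rewrite z1 w1 expr1n.
have := Creal_Re z; have := Creal_Re w.
move: ('Re z) ('Im z) ('Re w) ('Im w) => a b c d aR cR cd ab b0 d0.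
(* cos x - cos y and sin x + sin y multiply to (1 - cos (x + y)) sin (y - x). *)
rewrite subr_lt0 -subr_gt0 => adcb; rewrite -subr_gt0 -(pmulr_lgt0 _ (addr_gt0 b0 d0)).
have -> : (a - c) * (b + d) = (a * d - c * b) * (1 - a * c + b * d).
  transitivity (a * d - c * b - (a ^+ 2 + b ^+ 2) * (c * d) + (c ^+ 2 + d ^+ 2) * (a * b)).
    by rewrite -ab -cd; ring.
  by ring.
rewrite pmulr_rgt0 // ltr_wpDl ?mulr_gt0 // -(pmulr_rge0 _ (ltr0Sn _ 1)).
have -> : 2 * (1 - a * c) = (a - c) ^+ 2 + (b ^+ 2 + d ^+ 2).
  transitivity ((a ^+ 2 + b ^+ 2) + (c ^+ 2 + d ^+ 2) - 2 * a * c); last by ring.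
  by rewrite -ab -cd; ring.
by rewrite addr_ge0 ?real_exprn_even_ge0 ?rpredB ?addr_ge0 ?exprn_ge0 ?ltW.
Qed.

Lemma norm_unity (z : algC) N : (0 < N)%N -> z ^+ N = 1 -> `|z| = 1.
Proof.
move=> N0 zN; apply/eqP; rewrite -(@pexpr_eq1 _ `|z| N) //.
by rewrite -normrX zN normr1.
Qed.

Lemma real_norm1 (z : algC) : `|z| = 1 -> 'Im z = 0 -> z = 1 \/ z = -1.
Proof.
move=> z1 /Creal_ImP zR; have := real_normK zR; rewrite z1 expr1n => /esym/eqP.
by rewrite sqrf_eq1 => /orP[] /eqP; [left|right].
Qed.

Lemma invC_unity (z : algC) N : (0 < N)%N -> z ^+ N = 1 -> z^-1 = z^*%C.
Proof. by move=> N0 zN; rewrite invC_norm (norm_unity N0 zN) expr1n invr1 mul1r. Qed.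

Lemma max_Re_unity_root N : (2 < N)%N ->
  exists w : algC, [/\ w ^+ N = 1, 0 < 'Im w
    & forall z, z ^+ N = 1 -> 0 < 'Im z -> 'Re z <= 'Re w].
Proof.
move=> N2; have N0 : (0 < N)%N by apply: ltn_trans N2.
have [z zN] := C_prim_root_exists N0; have zN1 := prim_expr_order zN.
pose P (i : 'I_N) := 0 < 'Im (z ^+ i).
have PE w : w ^+ N = 1 -> 0 < 'Im w -> exists2 i, P i & w = z ^+ i.
  by move=> /(prim_rootP zN)[i ->] Iw; exists i.
(* As [N > 2], a primitive root is not real, so it or its conjugate lies in the upper half plane. *)
have [i0 Pi0] : exists i, P i.
  case: (real_ltgt0P (Creal_Im z)) => [Iz|Iz|Iz].
  - by have [i Pi _] := PE _ zN1 Iz; exists i.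
  - have zN1' : (z^*%C) ^+ N = 1 by rewrite -rmorphXn zN1 rmorph1.
    have Iz' : 0 < 'Im z^*%C by rewrite Im_conj oppr_gt0.
    by have [i Pi _] := PE _ zN1' Iz'; exists i.
  have zz : z ^+ 2 = 1 by case: (real_norm1 (norm_unity N0 zN1) Iz) => ->; rewrite ?sqrrN expr1n.
  have := prim_order_dvd zN 2; rewrite zz eqxx => /(@dvdn_leq _ 2 isT).
  by rewrite leqNgt N2.
case: (@real_arg_maxP algC _ i0 P (fun i => 'Re (z ^+ i)) Pi0) => [i _|i Pi max_i].
  exact: Creal_Re.
exists (z ^+ i); split=> // [|w wN Iw]; first by rewrite exprAC zN1 expr1n.
by have [j Pj ->] := PE _ wN Iw; apply: max_i.
Qed.

(* The root [w] is exp (i pi / n): it has the largest real part among the [2n]-th roots of unity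
  of the upper half plane, so none of them lies in the open sector between 1 and [w], and
  rotating by [w^-1] never jumps over the real axis. *)
Lemma first_unity_root n : (1 < n)%N ->
  exists w : algC, w ^+ n = -1 /\ forall k, (0 < k < n)%N -> 0 < 'Im (w ^+ k).
Proof.
move=> n1; have n0 : (0 < n)%N by apply: ltn_trans n1.
have N0 : (0 < n * 2)%N by rewrite muln_gt0 n0.
have [|w [wN Iw max_w]] := @max_Re_unity_root (n * 2); first by lia.
have w_neq0 : w != 0 by apply: contraTneq Iw => ->; rewrite raddf0 ltxx.
have unit1 k : (w ^+ k) ^+ (n * 2) = 1 by rewrite exprAC wN expr1n.
have small z : z ^+ (n * 2) = 1 -> 0 < 'Im z -> 'Im (z / w) < 0 -> False.
  move=> zN Iz Izw; have := max_w _ zN Iz; rewrite real_leNgt ?Creal_Re //.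
  by rewrite (Re_lt_of_Im_div_lt0 (norm_unity N0 zN) (norm_unity N0 wN)).
have ImV1 : 'Im w^-1 < 0 by rewrite (invC_unity N0 wN) Im_conj oppr_lt0.
(* [K] is the first positive exponent at which the powers of [w] leave the upper half plane; it will
   turn out to be [n]. *)
have [K /andP[K0 IK] minK] : {K | (0 < K)%N && ('Im (w ^+ K) <= 0)
    & forall k, (0 < k)%N && ('Im (w ^+ k) <= 0) -> (K <= k)%N}.
  have ex : exists k, (0 < k)%N && ('Im (w ^+ k) <= 0).
    exists (n * 2).-1.
    have -> : w ^+ (n * 2).-1 = w^-1.
      by apply: (mulfI w_neq0); rewrite -exprS prednK // wN divff.
    by rewrite (ltW ImV1) andbT; lia.
  by case: (ex_minnP ex) => K PK minK; exists K.
have posK k : (0 < k < K)%N -> 0 < 'Im (w ^+ k).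
  move=> /andP[k0 kK]; rewrite real_ltNge ?real0 ?Creal_Im //.
  by apply/negP => Ik; have := minK k; rewrite k0 Ik leqNgt kK => /(_ isT).
have K1 : (1 < K)%N.
  by rewrite ltn_neqAle K0 andbT; apply: contraTneq IK => <-; rewrite expr1 lt_geF.
have wKV : w ^+ K / w = w ^+ K.-1 by rewrite -{1}(prednK K0) exprSr mulfK.
have IK1 : 0 < 'Im (w ^+ K.-1) by apply: posK; lia.
(* If [w ^+ K] were below the real axis, [- w ^+ K] would lie in the empty sector between 1 and
   [w]. *)
have wK : w ^+ K = -1.
  have IK0 : 'Im (w ^+ K) = 0.
    apply/eqP; move: IK; rewrite le_eqVlt => /orP[//|IK]; exfalso.
    apply: (small (- w ^+ K)); first by rewrite mulnC exprM sqrrN -exprM mulnC unit1.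
      by rewrite raddfN oppr_gt0.
    by rewrite mulNr wKV raddfN oppr_lt0.
  case: (real_norm1 (norm_unity N0 (unit1 K)) IK0) => // E.
  by move: IK1; rewrite -wKV E mul1r => /(lt_trans ImV1); rewrite ltxx.
(* Divide [z] by [w] until it leaves the upper half plane: it must land on 1 or -1, both powers of
   [w]. *)
have powers z : z ^+ (n * 2) = 1 -> 0 < 'Im z -> exists i, z = w ^+ i.
  move=> zN Iz; have ex : exists i, 'Im (z / w ^+ i) <= 0.
    by exists K; rewrite wK invrN1 mulrN1 raddfN oppr_le0 ltW.
  case: (ex_minnP ex) => -[|i] Ii mini.
    by move: Ii; rewrite expr0 divr1 lt_geF.
  have zi k : (z / w ^+ k) ^+ (n * 2) = 1 by rewrite exprMn zN mul1r exprVn unit1 invr1.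
  have Ii' : 0 < 'Im (z / w ^+ i).
    by rewrite real_ltNge ?real0 ?Creal_Im //; apply/negP => /mini; rewrite ltnn.
  have {}Ii : 'Im (z / w ^+ i.+1) = 0.
    apply/eqP; move: Ii; rewrite le_eqVlt => /orP[//|Ii]; exfalso.
    by apply: (small (z / w ^+ i)); rewrite // -mulrA -invfM -exprSr Ii.
  have wi_neq0 : w ^+ i.+1 != 0 by rewrite expf_neq0.
  case: (real_norm1 (norm_unity N0 (zi i.+1)) Ii) => E.
    by exists i.+1; rewrite -[z](divfK wi_neq0) E mul1r.
  by exists (K + i.+1)%N; rewrite -[z](divfK wi_neq0) E exprD wK.
have KN : w ^+ (K * 2) = 1 by rewrite exprM wK sqrrN expr1n.
(* [K <= n] because [w ^+ n] is real; [n <= K] because every [2n]-th root of unity has order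
   dividing [2K]. *)
suff EK : K = n by exists w; split=> [|k]; rewrite -EK //; apply: posK.
apply/eqP; rewrite eqn_leq; apply/andP; split.
  apply: minK; rewrite n0; have : (w ^+ n) ^+ 2 = 1 by rewrite -exprM.
  move/eqP; rewrite sqrf_eq1 => /orP[]/eqP->.
    by rewrite (Creal_ImP _ _) ?real1 ?lexx.
  by rewrite (Creal_ImP _ _) ?rpredN ?real1 ?lexx.
have [z zN] := C_prim_root_exists N0; have zN1 := prim_expr_order zN.
suff : z ^+ (K * 2) = 1.
  move/eqP; rewrite -(prim_order_dvd zN) => /dvdn_leq; rewrite leq_pmul2r //.
  by apply; rewrite muln_gt0 K0.
case: (real_ltgt0P (Creal_Im z)) => [Iz|Iz|Iz].
- by have [i ->] := powers _ zN1 Iz; rewrite exprAC KN expr1n.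
- have [||i Ei] := powers z^*%C.
  + by rewrite -rmorphXn zN1 rmorph1.
  + by rewrite Im_conj oppr_gt0.
  by rewrite -[z]conjCK Ei -rmorphXn exprAC KN expr1n rmorph1.
by rewrite mulnC exprM; case: (real_norm1 (norm_unity N0 zN1) Iz) => ->;
  rewrite ?sqrrN !expr1n.
Qed.

Lemma triangle_parameter n : (2 < n)%N ->
  exists w l : algC, [/\ 0 < l, l = w + w^-1, n.-primitive_root (w ^+ 2) & unit_cusp l].
Proof.
move=> n2; have n1 : (1 < n)%N by apply: ltn_trans n2.
have n0 : (0 < n)%N by apply: ltn_trans n1.
have [w [wn w_pos]] := first_unity_root n1.
have w2n : w ^+ (n * 2) = 1 by rewrite exprM wn sqrrN expr1n.
have N0 : (0 < n * 2)%N by rewrite muln_gt0 n0.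
have wV := invC_unity N0 w2n.
have w_neq0 : w != 0.
  by apply: contra_eq_neq wn => ->; rewrite expr0n gtn_eqF // eq_sym oppr_eq0 oner_eq0.
have Iw : 0 < 'Im w by rewrite -[w]expr1 w_pos.
have lR : w + w^-1 \is Num.real.
  by apply/CrealP; rewrite rmorphD fmorphV /= -wV invrK addrC.
(* These are the sine quotients; since [w + w^-1] is real, the recurrence for powers of [w] passes
   to imaginary parts. *)
pose s k := 'Im (w ^+ k) / 'Im w.
have srec k : s k.+2 = (w + w^-1) * s k.+1 - s k.
  rewrite /s mulrA -mulrBl -ImMl // -raddfB /=; congr ('Im _ / _).
  by rewrite !exprS; field.
have s0 : s 0 = 0 by rewrite /s expr0 (Creal_ImP _ (real1 _)) mul0r.
have s1 : s 1 = 1 by rewrite /s expr1 divff // gt_eqF.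
have s_pos k : (0 < k < n)%N -> 0 < s k by move=> kn; rewrite divr_gt0 ?w_pos.
exists w, (w + w^-1); split=> //.
- by have := s_pos 2 n2; rewrite srec s0 s1 mulr1 subr0.
(* If [w ^+ 2] had order [m < n], then [w ^+ m] would be 1 or -1, hence real. *)
- have [|m mw mn] := @prim_order_exists algC n (w ^+ 2) n0; first by rewrite -exprM mulnC.
  suff -> : n = m by [].
  apply/eqP; rewrite eq_sym eqn_leq (dvdn_leq n0 mn) /= leqNgt; apply/negP => lt_mn.
  have m0 := prim_order_gt0 mw.
  have : 0 < 'Im (w ^+ m) by rewrite w_pos // m0.
  have /eqP := prim_expr_order mw; rewrite -exprM mulnC exprM sqrf_eq1.
  by case/orP=> /eqP->; rewrite (Creal_ImP _ _) ?rpredN ?real1 ?ltxx.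
apply: (@triangle_unit_cusp n s) => // [|k kn]; rewrite /s.
  by rewrite /s wn (Creal_ImP _ _) ?mul0r // rpredN real1.
have -> : w ^+ (n - k) = - (w^-1) ^+ k.
  by apply: (mulIf (expf_neq0 k w_neq0)); rewrite -exprD subnK // mulNr -exprMn mulVf // expr1n.
by rewrite wV -rmorphXn raddfN /= Im_conj opprK.
Qed.

(** * Algebraic integers with bounded conjugates *)

(** The map [x -> y] extends to a splitting field of the minimal polynomial, realised as a number
    field, and from there to [algC]. *)
Lemma minCpoly_root_aut x y :
  root (minCpoly x) y -> exists nu : {rmorphism algC -> algC}, nu x = y.
Proof.
move=> rxy; have [r Dp] := closed_field_poly_normal (minCpoly x).
rewrite (monicP (minCpoly_monic x)) scale1r in Dp.
have [Qs [QsC [rs Drs genQs]]] := num_field_exists r.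
have /mapP[x1 x1rs Dx] : x \in map QsC rs by rewrite Drs -root_prod_XsubC -Dp root_minCpoly.
have /mapP[y1 y1rs Dy] : y \in map QsC rs by rewrite Drs -root_prod_XsubC -Dp.
have [p [Ep mp] pP] := minCpolyP x.
have QsCE (a : rat) : QsC (a%:A) = ratr a by rewrite alg_num_field fmorph_rat.
have Dq : map_poly (in_alg Qs) p = \prod_(z <- rs) ('X - z%:P).
  apply: (map_inj_poly (fmorph_inj QsC) (rmorph0 _)).
  rewrite -map_poly_comp (eq_map_poly QsCE) -Ep Dp -Drs big_map rmorph_prod.
  by apply: eq_bigr => z _; rewrite rmorphB /= map_polyX map_polyC.
have splits : splittingFieldFor <<1; x1>> (map_poly (in_alg Qs) p) fullv.
  exists rs; first by rewrite Dq eqpxx.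
  by apply/eqP; rewrite eqEsubv subvf -genQs adjoin_seqSl // subv_adjoin.
(* [minPoly 1 x1] has rational coefficients and vanishes at [x], so [p] divides it, and [p] vanishes
   at [y]. *)
have root_y1 : root (map_poly \1%VF (minPoly 1 x1)) y1.
  rewrite (eq_map_poly (fun z => id_lfunE z)) map_poly_id //.
  have aP i : (minPoly 1 x1)`_i \in 1%VS by apply/polyOverP; apply: minPolyOver.
  have {}aP i := sig_eqW (vlineP _ _ (aP i)).
  have [q Eq] : exists q, minPoly 1 x1 = map_poly (in_alg Qs) q.
    exists (\poly_(i < size (minPoly 1 x1)) sval (aP i)).
    apply/polyP=> i; rewrite coef_map coef_poly /=.
    case: ltnP => [_|/(nth_default 0)->]; last by rewrite scale0r.
    by case: (aP i) => a /= ->.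
  have EqC : map_poly QsC (minPoly 1 x1) = map_poly ratr q.
    by rewrite Eq -map_poly_comp (eq_map_poly QsCE).
  have : root (map_poly ratr q) x by rewrite -EqC Dx fmorph_root root_minPoly.
  rewrite pP => /dvdpP[q' Eq']; rewrite -(fmorph_root QsC) -Dy EqC Eq' rmorphM rootM.
  by rewrite /= -Ep rxy orbT.
have homx := kHomExtendP (subvv _) (kHom1 1 1) root_y1.
have Kp : map_poly (in_alg Qs) p \is a polyOver 1%VS.
  by apply/polyOverP=> i; rewrite coef_map rpredZ ?mem1v.
have [g /kHom_monoid_morphism gM gx] := kHom_extends (sub1v _) homx Kp splits.
pose gMM := GRing.isMonoidMorphism.Build _ _ g gM.
pose gRM : {rmorphism _ -> _} := HB.pack (fun_of_lfun g) gMM.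
have [nu Dnu] := extend_algC_subfield_aut QsC gRM.
exists nu; rewrite Dx -Dnu /= -gx ?memv_adjoin // Dy.
by rewrite (kHomExtend_val (kHom1 1 1) root_y1).
Qed.

(** All roots share one minimal polynomial, which cannot divide its nonzero derivative of smaller
    degree. *)
Lemma minCpoly_roots_uniq x r :
  minCpoly x = \prod_(y <- r) ('X - y%:P) -> uniq r.
Proof.
move=> Dp; rewrite -separable_prod_XsubC -Dp separable_poly.unlock.
apply: Pdiv.ClosedField.root_coprimep => y /minCpoly_root_aut[nu Ey].
rewrite -(minCpoly_aut nu) Ey; have [p [-> mp] pP] := minCpolyP y.
have szp : (1 < size p)%N.
  by rewrite -(size_map_poly (ratr : {rmorphism rat -> algC})); apply: root_size_gt1 (_ : root _ y);
    rewrite ?map_poly_eq0 ?monic_neq0 ?pP.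
have nz : p^`() != 0.
  apply/eqP => /(congr1 (fun u : {poly rat} => u`_(size p).-2)).
  rewrite coef_deriv coef0 -subn2 -subSn // subSS subn1 -lead_coefE (monicP mp).
  by apply/eqP; rewrite pnatr_eq0 -lt0n; lia.
rewrite deriv_map; apply/negP; rewrite -/(root _ _) pP => /(dvdp_leq nz).
by rewrite leqNgt lt_size_deriv // monic_neq0.
Qed.

(* Reduced modulo the minimal polynomial, the [f k] are determined by their values at the conjugates
  of [q] (Vandermonde), so their integer coefficients are bounded: pigeonhole. *)
Lemma bounded_conjugates_collision q (f : nat -> {poly int}) (B : algC) :
    q \in Aint ->
    (forall k (nu : {rmorphism algC -> algC}), `|(map_poly intr (f k)).[nu q]| <= B) ->
  exists j k, (j < k)%N /\
    (map_poly intr (f j)).[q] = (map_poly intr (f k)).[q] :> algC.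
Proof.
move=> qZ fB; have [r Dp] := closed_field_poly_normal (minCpoly q).
rewrite (monicP (minCpoly_monic q)) scale1r in Dp.
have ur := minCpoly_roots_uniq Dp.
have [p Ep] := floorpP (qZ : minCpoly q \is a polyOver Num.int).
have mp : p \is monic.
  rewrite monicE -(eqr_int algC) -lead_coef_map_inj ?rmorph0 //; last exact: intr_inj.
  by rewrite -Ep; apply: minCpoly_monic.
pose g k := Pdiv.Ring.rmodp (f k) p.
have gE k y : root (minCpoly q) y -> (map_poly intr (g k)).[y] = (map_poly intr (f k)).[y] :> algC.
  move=> /rootP py; rewrite [in RHS](Pdiv.RingMonic.rdivp_eq mp (f k)).
  by rewrite rmorphD rmorphM /= hornerD hornerM -Ep py mulr0 add0r.
pose d := size r.
have gd k : (size (g k) <= d)%N.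
  have : (size (g k) < size p)%N by rewrite Pdiv.Ring.ltn_rmodp monic_neq0.
  rewrite -(size_map_inj_poly (f := intr : int -> algC)) //; last exact: intr_inj.
  by rewrite -Ep Dp size_prod_XsubC.
pose v : 'rV[algC]_d := \row_j r`_j.
pose V := Vandermonde d v.
have Vu : V \in unitmx.
  rewrite unitmxE det_Vandermonde unitfE prodf_seq_neq0; apply/allP => i _ /=.
  rewrite prodf_seq_neq0; apply/allP => j _ /=; apply/implyP => ij.
  by rewrite !mxE subr_eq0 nth_uniq // gtn_eqF.
pose a k : 'rV[algC]_d := \row_i ((g k)`_i)%:~R.
have aV k : a k *m V = \row_j (map_poly intr (g k)).[r`_j].
  apply/rowP => j; rewrite !mxE (horner_coef_wide _ (leq_trans (size_poly _ _) (gd k))).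
  by apply: eq_bigr => i _; rewrite !mxE coef_map.
have B0 : 0 <= B by apply: le_trans (fB 0 idfun).
(* Inverting the Vandermonde matrix bounds the coefficients by the values, uniformly in [k]. *)
pose C := Num.bound (\sum_i \sum_j B * `|invmx V j i|).
have aC k (i : 'I_d) : (absz ((g k)`_i)%R <= C)%N.
  have : `|((g k)`_i)%:~R| <= C%:R :> algC.
    have -> : ((g k)`_i)%:~R = (\row_j (map_poly intr (g k)).[r`_j] *m invmx V) 0 i :> algC.
      by rewrite -aV mulmxK // mxE.
    rewrite mxE; apply: le_trans (ler_norm_sum _ _ _) _.
    apply: (@le_trans _ _ (\sum_j B * `|invmx V j i|)).
      apply: ler_sum => j _; rewrite mxE normrM ler_wpM2r //.
      have rj : root (minCpoly q) r`_j by rewrite Dp root_prod_XsubC mem_nth.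
      by rewrite gE //; have [nu <-] := minCpoly_root_aut rj; apply: fB.
    apply: le_trans (ltW (archi_boundP _)); last first.
      by apply: sumr_ge0 => ? _; apply: sumr_ge0 => ? _; rewrite mulr_ge0.
    rewrite [leRHS](bigD1 i) //= lerDl.
    by apply: sumr_ge0 => ? _; apply: sumr_ge0 => ? _; rewrite mulr_ge0.
  by rewrite -intr_norm -[C%:R]/((C%:Z)%:~R) ler_int -abszE.
(* Adding [C] moves the coefficients from [[-C, C]] into [[0, 2C]], where [inord] loses nothing. *)
pose code (k : nat) : {ffun 'I_d -> 'I_(C + C).+1} :=
  [ffun i : 'I_d => inord (absz ((g k)`_i + C%:Z))].
have codeP j k : code j = code k -> g j = g k.
  move=> E; apply/polyP => i; have [ltid|] := ltnP i d; last first.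
    by move=> di; rewrite !nth_default // (leq_trans (gd _)).
  have /ffunP/(_ (Ordinal ltid)) := E; rewrite !ffunE /= => /(congr1 val).
  have := aC j (Ordinal ltid); have := aC k (Ordinal ltid); rewrite /= => ck cj.
  by rewrite /= !inordK; lia.
pose M := #|{ffun 'I_d -> 'I_(C + C).+1}|.
have : ~~ injectiveb (fun k : 'I_M.+1 => code k).
  by apply/injectiveP => /leq_card; rewrite card_ord ltnn.
case/injectivePn => j [k jk /codeP E].
have qr : root (minCpoly q) q by apply: root_minCpoly.
have val_eq : (map_poly intr (f j)).[q] = (map_poly intr (f k)).[q] :> algC.
  by rewrite -!gE // E.
case: (ltngtP j k) => [lt|lt|/val_inj E']; last by rewrite E' eqxx in jk.
  by exists j, k.
by exists k, j.
Qed.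

(** Chebyshev recurrence in [q = 2 + w + w^-1]: the next trace is [q - 2] times the current one
    minus the previous one, so the induction carries a consecutive pair. *)
Lemma power_trace_poly k : {p : {poly int} |
  forall w : algC, w != 0 -> (map_poly intr p).[2 + w + w^-1] = w ^+ k + (w ^+ k)^-1}.
Proof.
suff [] : {p : {poly int} * {poly int} | forall w : algC, w != 0 ->
    (map_poly intr p.1).[2 + w + w^-1] = w ^+ k + (w ^+ k)^-1 /\
    (map_poly intr p.2).[2 + w + w^-1] = w ^+ k.+1 + (w ^+ k.+1)^-1}.
  by move=> p pP; exists p.1 => w /pP[].
elim: k => [|k [[p p'] pP]].
  exists (2%:P, 'X - 2%:P) => w w0; rewrite rmorphB /= map_polyX !map_polyC /= !hornerE.
  by rewrite expr0 invr1 expr1; split=> //; ring.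
exists (p', ('X - 2%:P) * p' - p) => w w0; have [/= E1 E2] := pP w w0; split=> //=.
rewrite rmorphB rmorphM rmorphB /= map_polyX map_polyC /= !hornerE E1 E2 !exprS.
by field; rewrite w0 expf_neq0.
Qed.

(** A real trace forces the conjugate of [w] to be [w] or [w^-1]. For real [w] the squared trace is
    [(w - w^-1) ^+ 2 + 4 >= 4]. *)
Lemma norm_eq1_of_trace (w : algC) : w != 0 -> w + w^-1 \is Num.real ->
  `|w + w^-1| < 2 -> `|w| = 1.
Proof.
move=> w0 tR t2; have wcV : (w^*%C - w) * (w^*%C - w^-1) = 0.
  have wc0 : w^*%C != 0 by rewrite conjC_eq0.
  have := conj_Creal tR; rewrite rmorphD fmorphV /= => E.
  have -> : (w^*%C - w) * (w^*%C - w^-1) = w^*%C * ((w^*%C + (w^*%C)^-1) - (w + w^-1)).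
    by field; rewrite w0 wc0.
  by rewrite E subrr mulr0.
move/eqP: wcV; rewrite mulf_eq0 !subr_eq0 => /orP[|] /eqP E; last first.
  by apply/eqP; rewrite -(@pexpr_eq1 _ _ 2) // normCK E divff.
have wR : w \is Num.real by apply/CrealP.
have : (w + w^-1) ^+ 2 < 2 ^+ 2.
  by rewrite -real_normK // ltr_pXn2r ?nnegrE.
have -> : (w + w^-1) ^+ 2 = (w - w^-1) ^+ 2 + 2 ^+ 2 by field.
rewrite gtrDr => /lt_geF; rewrite real_exprn_even_ge0 // rpredB ?rpredV //.
Qed.

(** Kronecker's argument: with [z + z^-1 = q - 2], all conjugates of [z] lie on the unit circle, so
    the traces of powers of [z] are bounded by 2. Two of them coincide, which makes [z] a root of
    unity. *)
Lemma totally_positive_lt4 q : q \in Aint ->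
    (forall nu : {rmorphism algC -> algC}, 0 < nu q < 4) ->
  exists n z, [/\ (2 < n)%N, n.-primitive_root z & q = 2 + z + z^-1].
Proof.
move=> qZ q04; pose c := sqrtC ((q - 2) ^+ 2 - 2 ^+ 2); pose z := (q - 2 + c) / 2.
have zz : z * ((q - 2 - c) / 2) = 1.
  by rewrite mulf_div [X in X / _]mulrC -subr_sqr sqrtCK; field.
have z0 : z != 0 by apply: contra_eq_neq zz => ->; rewrite mul0r eq_sym oner_eq0.
have zV : z^-1 = (q - 2 - c) / 2 by apply: (mulfI z0); rewrite zz divff.
have qE : q = 2 + z + z^-1 by rewrite zV /z; field.
have nuqE (nu : {rmorphism algC -> algC}) : nu q = 2 + nu z + (nu z)^-1.
  by rewrite {1}qE rmorphD rmorphD rmorph_nat fmorphV.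
have nuz1 (nu : {rmorphism algC -> algC}) : `|nu z| = 1.
  have /andP[q0 q4] := q04 nu; have E : nu z + (nu z)^-1 = nu q - 2 by rewrite nuqE; ring.
  have tR : nu q - 2 \is Num.real by rewrite rpredB ?gtr0_real ?realn.
  apply: norm_eq1_of_trace; rewrite ?fmorph_eq0 ?E //.
  rewrite real_ltr_norml // ltrBrDr ltrBlDr addNr q0 /=.
  by have -> : 2 + 2 = 4 :> algC by ring.
pose f k := sval (power_trace_poly k).
have fE k := svalP (power_trace_poly k).
have [|j [k [jk E]]] := @bounded_conjugates_collision q f 2 qZ.
  move=> k nu; rewrite nuqE fE ?fmorph_eq0 //; apply: le_trans (ler_normD _ _) _.
  by rewrite normfV normrX nuz1 expr1n invr1.
rewrite qE !fE // in E.
have [m m0 zm] : exists2 m, (0 < m)%N & z ^+ m = 1.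
  have : (z ^+ (k - j) - 1) * (z ^+ (k + j) - 1) = 0.
    have zk : z ^+ k = z ^+ (k - j) * z ^+ j by rewrite -exprD subnK // ltnW.
    transitivity (z ^+ k * (z ^+ k + (z ^+ k)^-1 - (z ^+ j + (z ^+ j)^-1))); last first.
      by rewrite E subrr mulr0.
    by rewrite exprD zk; field; rewrite !expf_neq0.
  move/eqP; rewrite mulf_eq0 !subr_eq0 => /orP[] /eqP Em.
    by exists (k - j)%N; rewrite ?subn_gt0.
  by exists (k + j)%N => //; lia.
have [n zn _] := prim_order_exists m0 zm.
exists n, z; split=> //; have n0 := prim_order_gt0 zn; have z1 := prim_expr_order zn.
have /andP[q0 q4] := q04 idfun; rewrite /= in q0 q4.
have E4 : 2 + 1 + 1 = 4 :> algC by ring.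
(* Orders 1 and 2 would give [q = 4] or [q = 0]. *)
case: n n0 zn z1 => [|[|[|n]]] // _ zn z1.
  by move: q4; rewrite qE -[z]expr1 z1 invr1 E4 ltxx.
move/eqP: z1; rewrite sqrf_eq1 => /orP[] /eqP Ez.
  by move: q4; rewrite qE Ez invr1 E4 ltxx.
by move: q0; rewrite qE Ez invrN1 addrK subrr ltxx.
Qed.

(** * Uniqueness by passing to a favourable conjugate of [q] *)

Theorem theorem3 (q : algC) (q_pos : 0 < q) :
  ((exists sigma : {rmorphism algC -> algC},
       sigma q \is Num.real /\ 4 <= sigma q)
   \/ (q \in Aint /\ forall sigma : {rmorphism algC -> algC}, 0 < sigma q)) ->
  weight_unique q.
Proof.
have ge4 (nu : {rmorphism algC -> algC}) : 4 <= nu q -> weight_unique q.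
  move=> q4; have q0 : 0 < nu q by apply: lt_le_trans q4; rewrite ltr0n.
  apply: (weight_unique_aut q_pos q0); rewrite -[nu q]sqrtCK.
  apply: unit_cusp_weight_unique; first by rewrite sqrtC_gt0.
  apply: unit_cusp_ge2; rewrite -(@ler_pXn2r _ 2) ?nnegrE ?sqrtC_ge0 ?(ltW q0) //.
  by rewrite sqrtCK -natrX.
case=> [[nu [_ /ge4]]|[qZ q_tpos]] //.
(* A totally positive integer either has a conjugate at least 4, as in the first case, or has all
   its conjugates in [(0, 4)]. *)
case: (classic (exists nu : {rmorphism algC -> algC}, 4 <= nu q)) => [[nu /ge4]|lt4] //.
have [nu|n [z [n2 zn qE]]] := totally_positive_lt4 qZ.
  rewrite q_tpos real_ltNge ?gtr0_real ?ltr0n //.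
  by apply/negP => nu4; apply: lt4; exists nu.
(* [z] and [w ^+ 2] are primitive of the same order, so an automorphism maps [z] to [w ^+ 2], hence
   [q] to [(w + w^-1) ^+ 2 = l ^+ 2]. *)
have [w [l [l0 lE wn l_unit]]] := triangle_parameter n2.
have [k wk] := prim_rootP zn (prim_expr_order wn).
have kn : coprime k n by rewrite -(prim_root_exp_coprime k zn) -wk.
have [nu nuE] := Qn_aut_exists kn.
have nuq : nu q = l ^+ 2.
  have w0 : w != 0 by apply: contraTneq l0; rewrite lE => ->; rewrite invr0 addr0 ltxx.
  rewrite qE rmorphD rmorphD rmorph_nat fmorphV (nuE _ (prim_expr_order zn)) -wk lE.
  by field.
apply: (weight_unique_aut (nu := nu)) => //; rewrite nuq ?exprn_gt0 //.
exact: unit_cusp_weight_unique.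
Qed.
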